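(* Let $I \subset \mathbb{R}$ be an interval and let $x_0 \in I$. (a) (Right-sided version, where $x_0 \neq \sup I$.) The family of all quasi-arithmetic means $A^{[f]}$ generated by continuous, strictly monotone functions $f \colon I \to \mathbb{R}$ that are right-sided differentiable at $x_0$ with $f'_+(x_0) = 0$ is an interval-type set in the family of all quasi-arithmetic means on $I$. (b) (Left-sided version, where $x_0 \neq \inf I$.) The family of all quasi-arithmetic means $A^{[f]}$ generated by continuous, strictly monotone functions $f \colon I \to \mathbb{R}$ that are left-sided differentiable at $x_0$ with $f'_-(x_0) = 0$ is an interval-type set in the family of all quasi-arithmetic means on $I$.
   Context: For an interval $I\subset\mathbb{R}$ and a continuous, strictly monotone function $f \colon I \to \mathbb{R}$, the quasi-arithmetic mean generated by $f$ is the function $A^{[f]} \colon \bigcup_{n=1}^\infty I^n \to I$, $A^{[f]}(a_1,\dots,a_n) := f^{-1}\left(\frac{f(a_1)+\cdots+f(a_n)}{n}\right)$. For two such functions $f,g$ on the same interval $I$, $A^{[f]} \le A^{[g]}$ means $A^{[f]}(a) \le A^{[g]}(a)$ for all $a \in \bigcup_{n=1}^\infty I^n$. A set $\mathcal{I}$ of quasi-arithmetic means on $I$ is called an interval-type set (or interval) if, whenever $A^{[f]}, A^{[g]} \in \mathcal{I}$ and $A^{[h]}$ is a quasi-arithmetic mean on $I$ with $A^{[f]} \le A^{[h]} \le A^{[g]}$, then $A^{[h]} \in \mathcal{I}$. Here $f'_+(x_0)$, $f'_-(x_0)$ denote the right and left derivatives, and one-sided differentiability means that the corresponding derivative exists as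 a finite number. *)

(* Defs.v *)
From HB Require Import structures.
From mathcomp Require Import all_boot all_order all_algebra.
From mathcomp Require Import all_classical all_reals all_analysis.

Set Implicit Arguments.
Unset Strict Implicit.
Unset Printing Implicit Defensive.

Import Order.TTheory GRing.Theory Num.Theory.
Import numFieldNormedType.Exports.

Local Open Scope classical_set_scope.
Local Open Scope ring_scope.

Section QuasiArithmeticMeans.
Variable R : realType.
Implicit Types (I : set R) (f : R -> R).

Definition strictly_monotone_on I f : Prop :=
  {in I &, {homo f : x y / x < y}} \/ {in I &, {homo f : x y /~ x < y}}.

(* A generator is a total function of which only the restriction to I matters;
   {within I, continuous f} is continuity of that restriction. *)
Definition generator I f : Prop :=
  {within I, continuous f} /\ strictly_monotone_on I f.

(* Maps from the disjoint union of the I^n, n >= 1, to I. The arguments range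
   over the subtype of I, so that two means are equal as elements of this type
   exactly when they agree on all tuples of points of I. *)
Definition mean I : Type := forall n : nat, n.+1.-tuple I -> I.

(* The inverse is that of the restriction of f to I; its default value
   [thead a] is only used if the average is outside f(I), which never happens
   for a generator on an interval. *)
Definition qa_mean I f : mean I := fun n a =>
  'pinv_(fun=> thead a) [set: I] (fun x : I => f (val x))
    ((\sum_(i < n.+1) f (val (tnth a i))) / n.+1%:R).

Definition mean_le I (M N : mean I) : Prop :=
  forall (n : nat) (a : n.+1.-tuple I), val (M n a) <= val (N n a).

Definition qa_means I : set (mean I) :=
  [set qa_mean f | f in generator I].

Definition interval_type I (S : set (mean I)) : Prop :=
  S `<=` @qa_means I /\
  forall F G H : mean I, S F -> S G -> qa_means H ->
    mean_le F H -> mean_le H G -> S H.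

(* Existence of a finite one-sided derivative, with value l. Since only values
   of f near x on the given side are used, this depends only on the restriction
   of f to an interval containing x when x is not its endpoint on that side. *)
Definition is_right_derive f (x l : R) : Prop :=
  (f (x + h) - f x) / h @[h --> 0^'+] --> l.

Definition is_left_derive f (x l : R) : Prop :=
  (f (x + h) - f x) / h @[h --> 0^'-] --> l.

Definition right_flat_means I (x0 : R) : set (mean I) :=
  [set qa_mean f | f in [set f | generator I f /\ is_right_derive f x0 0]].

Definition left_flat_means I (x0 : R) : set (mean I) :=
  [set qa_mean f | f in [set f | generator I f /\ is_left_derive f x0 0]].

End QuasiArithmeticMeans.

(* Main.v *)
(* Write t_f(x) = (f x - f a) / (f b - f a), which increases with x on an
   interval I whichever way f is monotone. The mean A^[f] of k copies of b and
   n - k copies of a is the point where t_f takes the value k / n, so that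
   A^[f] <= A^[h] forces t_h <= t_f on [a, b]. Anchoring a at x0 bounds the right
   difference quotient of h at x0 by a multiple of that of f; anchoring b at x0
   bounds the left difference quotient of h by a multiple of that of g when
   A^[h] <= A^[g]. *)
Require Import Defs.
From HB Require Import structures.
From mathcomp Require Import all_boot all_order all_algebra.
From mathcomp Require Import all_classical all_reals all_analysis.
From mathcomp Require Import ring lra.

Import Order.TTheory GRing.Theory Num.Theory.
Import numFieldNormedType.Exports.

Local Open Scope classical_set_scope.
Local Open Scope ring_scope.

(** Density of the rationals, with the bound [k <= n.+1] added so that the fraction can be realised
    as the share of [b] among the entries of an [n.+1]-tuple. *)
Lemma nat_frac_between {R : realType} (s t : R) : 0 <= s -> s < t -> t <= 1 ->
  exists n k : nat, (k <= n.+1)%N /\ s < k%:R / n.+1%:R < t.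
Proof.
(* This choice makes the step [1 / n.+1] shorter than [t - s], so the multiples of it cannot jump
   over the gap. *)
move=> s0 st t1; pose n := Num.truncn (t - s)^-1.
have ts0 : 0 < t - s by rewrite subr_gt0.
have N0 : 0 < n.+1%:R :> R by rewrite ltr0n.
have hn : 1 < n.+1%:R * (t - s).
  by rewrite -ltr_pdivrMr // div1r truncnS_gt.
(* The last multiple not exceeding [s] has numerator [k]; the witness is the next one, [k.+1]. *)
pose k := Num.truncn (s * n.+1%:R).
have /andP[hk1 hk2] : k%:R <= s * n.+1%:R < k.+1%:R.
  by apply: truncn_itv; rewrite mulr_ge0 // ltW.
have hkt : s < k.+1%:R / n.+1%:R < t.
  rewrite ltr_pdivlMr // hk2 ltr_pdivrMr //= -addn1 natrD.
  by nra.
exists n, k.+1; split => //.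
have := lt_le_trans (andP hkt).2 t1.
by rewrite ltr_pdivrMr // mul1r ltr_nat => /ltnW.
Qed.

Lemma sum_ord_threshold {V : zmodType} (n k : nat) (u v : V) : (k <= n)%N ->
  \sum_(i < n) (if (i < k)%N then v else u) = v *+ k + u *+ (n - k).
Proof.
move=> kn; rewrite -(big_mkord xpredT (fun i => if (i < k)%N then v else u)).
rewrite (big_cat_nat (leq0n k) kn) //=; congr (_ + _).
  rewrite (eq_big_nat _ _ (F2 := fun=> v)) ?sumr_const_nat ?subn0 //.
  by move=> i /andP[_ ->].
rewrite (eq_big_nat _ _ (F2 := fun=> u)) ?sumr_const_nat //.
by move=> i /andP[ki _]; rewrite ltnNge ki.
Qed.

Section RelativePosition.
Context {R : realType}.
Implicit Types (I : set R) (f g h : R -> R).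

Definition relpos f (a b x : R) : R := (f x - f a) / (f b - f a).

Lemma strictly_monotone_on_neq I f (a b : R) :
  strictly_monotone_on I f -> I a -> I b -> a < b -> f b - f a != 0.
Proof.
move=> [fm|fm] /mem_set Ia /mem_set Ib ab; rewrite subr_eq0.
  by rewrite gt_eqF // fm.
by rewrite lt_eqF // fm.
Qed.

Lemma relpos_lt I f (a b : R) : strictly_monotone_on I f ->
  I a -> I b -> a < b -> {in I &, {homo relpos f a b : x y / x < y}}.
Proof.
move=> fm /mem_set Ia /mem_set Ib ab x y Ix Iy xy; rewrite /relpos.
case: fm => fm; first by rewrite ltr_pM2r ?ltrD2r ?fm // invr_gt0 subr_gt0 fm.
by rewrite ltr_nM2r ?ltrD2r ?fm // invr_lt0 subr_lt0 fm.
Qed.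

Lemma relpos_left f (a b : R) : relpos f a b a = 0.
Proof. by rewrite /relpos subrr mul0r. Qed.

Lemma relpos_right f (a b : R) : f b - f a != 0 -> relpos f a b b = 1.
Proof. exact: divff. Qed.

Lemma relpos_itv I f (a b x : R) : strictly_monotone_on I f ->
  I a -> I b -> I x -> a < x -> x < b -> 0 < relpos f a b x < 1.
Proof.
move=> fm Ia Ib Ix ax xb; have ab := lt_trans ax xb.
have fab := strictly_monotone_on_neq _ _ _ _ fm Ia Ib ab.
rewrite -{1}(relpos_left f a b) -[X in _ && (_ < X)](relpos_right _ _ _ fab).
by rewrite !(relpos_lt _ _ _ _ fm Ia Ib ab) ?inE.
Qed.

Definition two_valued_tuple {I} n k (a b : I) : n.+1.-tuple I :=
  [tuple if (i < k)%N then b else a | i < n.+1].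

Lemma relpos_qa_mean_two_valued I f n k (a b : I) :
  is_interval I -> generator I f -> val a < val b -> (k <= n.+1)%N ->
  relpos f (val a) (val b) (val (qa_mean f (two_valued_tuple n k a b)))
  = k%:R / n.+1%:R.
Proof.
move=> itvI [fc fm] ab kn.
have Ia : I (val a) by apply: set_mem; exact: valP.
have Ib : I (val b) by apply: set_mem; exact: valP.
have fab := strictly_monotone_on_neq _ _ _ _ fm Ia Ib ab.
have N0 : 0 < n.+1%:R :> R by rewrite ltr0n.
set avg := f (val a) + k%:R / n.+1%:R * (f (val b) - f (val a)).
have sumE : (\sum_(i < n.+1) f (val (tnth (two_valued_tuple n k a b) i))) / n.+1%:R
    = avg.
  under eq_bigr => i _ do rewrite tnth_mktuple (fun_if val) (fun_if f).
  rewrite sum_ord_threshold // -[_ *+ k]mulr_natr -[_ *+ (_ - _)]mulr_natr.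
  by rewrite natrB // /avg; field; rewrite nat1r pnatr_eq0.
have k01 : 0 <= (k%:R / n.+1%:R : R) <= 1.
  by rewrite divr_ge0 // ler_pdivrMr // mul1r ler_nat.
(* The average lies between [f (val a)] and [f (val b)], hence is a value of [f] on [I]: the partial
   inverse is a true inverse there and its default is not reached. *)
have [c cab fcE] : exists2 c, c \in `[val a, val b] & f c = avg.
  apply: IVT; first exact: ltW.
    apply: continuous_subspaceW fc => z /=; rewrite in_itv /=.
    exact: itvI.
  rewrite /avg; move: (k%:R / _) k01 => t /andP[t0 t1].
  by have [?|?] := leP (f (val a)) (f (val b)); nra.
have Ic : I c by move: cab; rewrite in_itv /=; exact: itvI.
rewrite /qa_mean sumE /relpos.
set p := 'pinv_ _ _ _.
have -> : f (val (p avg)) = avg.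
  apply: (@pinvK _ _ _ _ (fun x : I => f (val x))).
  by rewrite inE; exists (SigSub (mem_set Ic)).
by rewrite /avg addrC addKr mulfK.
Qed.

(** Otherwise some [k / n.+1] lies strictly between the two relative positions of [x], and the
    corresponding two-valued tuple has its [h]-mean below [x] and its [f]-mean above. *)
Lemma mean_le_relpos I f h (a b x : R) : is_interval I ->
  generator I f -> generator I h -> I a -> I b -> a < x -> x < b ->
  mean_le (@qa_mean R I f) (@qa_mean R I h) ->
  relpos h a b x <= relpos f a b x.
Proof.
move=> itvI fg hg Ia Ib ax xb fh; rewrite leNgt; apply/negP => fxhx.
have ab := lt_trans ax xb.
have Ix : I x by apply: (itvI a b Ia Ib); rewrite !ltW.
have /andP[f0 _] := relpos_itv _ _ _ _ _ fg.2 Ia Ib Ix ax xb.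
have /andP[_ h1] := relpos_itv _ _ _ _ _ hg.2 Ia Ib Ix ax xb.
have [n [k [kn /andP[fk kh]]]] :=
  nat_frac_between _ _ (ltW f0) fxhx (ltW h1).
pose a' : I := SigSub (mem_set Ia); pose b' : I := SigSub (mem_set Ib).
have := fh _ (two_valued_tuple n k a' b'); apply/negP; rewrite -ltNge.
have fM := relpos_qa_mean_two_valued _ f n k a' b' itvI fg ab kn.
have hM := relpos_qa_mean_two_valued _ h n k a' b' itvI hg ab kn.
apply: (@lt_trans _ _ x).
  rewrite ltNge le_eqVlt; apply/negP => /predU1P[xM|xM].
    by move: kh; rewrite -hM -xM ltxx.
  have := relpos_lt _ _ _ _ hg.2 Ia Ib ab _ _ (mem_set Ix) (valP _) xM.
  by rewrite hM ltNge (ltW kh).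
rewrite ltNge le_eqVlt; apply/negP => /predU1P[xM|xM].
  by move: fk; rewrite -fM xM ltxx.
have := relpos_lt _ _ _ _ fg.2 Ia Ib ab _ _ (valP _) (mem_set Ix) xM.
by rewrite fM ltNge (ltW fk).
Qed.

Lemma cvg0_dominated {T} {F : set_system T} {FF : Filter F} (u v : T -> R) C :
  (\forall d \near F, `|u d| <= C * `|v d|) ->
  v d @[d --> F] --> 0 -> u d @[d --> F] --> 0.
Proof.
move=> uv v0; apply/norm_cvg0P.
apply: (@squeeze_cvgr _ _ _ _ (fun=> 0) (fun d => C * `|v d|)).
- by apply: filterS uv => d ->; rewrite normr_ge0.
- exact: cvg_cst.
- by rewrite -(mulr0 C); apply: cvgMr; apply/norm_cvg0P.
Qed.

Lemma sup_neq_gt I (x : R) : I x -> x%:E <> ereal_sup (EFin @` I) ->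
  exists2 y, I y & x < y.
Proof.
move=> Ix xsup; apply: contrapT => noy; apply: xsup.
apply/eqP; rewrite eq_le; apply/andP; split.
  by apply: ereal_sup_ubound; exists x.
apply: ge_ereal_sup => _ [y Iy <-]; rewrite lee_fin leNgt; apply/negP => xy.
by apply: noy; exists y.
Qed.

Lemma inf_neq_lt I (x : R) : I x -> x%:E <> ereal_inf (EFin @` I) ->
  exists2 y, I y & y < x.
Proof.
move=> Ix xinf; apply: contrapT => noy; apply: xinf.
apply/eqP; rewrite eq_le; apply/andP; split; last first.
  by apply: ereal_inf_lbound; exists x.
apply: le_ereal_inf_tmp => _ [y Iy <-]; rewrite lee_fin leNgt; apply/negP => xy.
by apply: noy; exists y.
Qed.

Lemma is_right_derive0_mean_le I f h (x0 b : R) : is_interval I ->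
  generator I f -> generator I h -> I x0 -> I b -> x0 < b ->
  mean_le (@qa_mean R I f) (@qa_mean R I h) ->
  is_right_derive f x0 0 -> is_right_derive h x0 0.
Proof.
move=> itvI fg hg Ia Ib ab fh.
have hab := strictly_monotone_on_neq _ _ _ _ hg.2 Ia Ib ab.
(* The constant comes from clearing denominators in [relpos h x0 b <= relpos f x0 b]. *)
apply: (@cvg0_dominated _ _ _ _ _ (`|h b - h x0| / `|f b - f x0|)).
near=> d.
have d0 : 0 < d by near: d; exact: nbhs_right_gt.
have xd : x0 < x0 + d by rewrite ltrDl.
have db : x0 + d < b.
  by rewrite -ltrBrDl; near: d; apply: nbhs_right_lt; rewrite subr_gt0.
have Ix : I (x0 + d) by apply: (itvI x0 b Ia Ib); rewrite !ltW.
have := mean_le_relpos _ _ _ _ _ _ itvI fg hg Ia Ib xd db fh.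
have /andP[f0 _] := relpos_itv _ _ _ _ _ fg.2 Ia Ib Ix xd db.
have /andP[h0 _] := relpos_itv _ _ _ _ _ hg.2 Ia Ib Ix xd db.
(* Both sides are positive, so absolute values may be inserted; they absorb the possibly different
   directions of monotonicity of [f] and [h]. *)
rewrite -(gtr0_norm f0) -(gtr0_norm h0) /relpos !normf_div.
rewrite ler_pdivrMr ?normr_gt0 // => le_hf.
rewrite mulrA ler_pM2r ?invr_gt0 ?normr_gt0 ?gt_eqF //.
by rewrite mulrAC -mulrA mulrC.
Unshelve. all: by end_near. Qed.

Lemma is_left_derive0_mean_le I g h (x0 a : R) : is_interval I ->
  generator I g -> generator I h -> I x0 -> I a -> a < x0 ->
  mean_le (@qa_mean R I h) (@qa_mean R I g) ->
  is_left_derive g x0 0 -> is_left_derive h x0 0.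
Proof.
move=> itvI gg hg Ib Ia ab hlg.
have gab := strictly_monotone_on_neq _ _ _ _ gg.2 Ia Ib ab.
have hab := strictly_monotone_on_neq _ _ _ _ hg.2 Ia Ib ab.
apply: (@cvg0_dominated _ _ _ _ _ (`|h x0 - h a| / `|g x0 - g a|)).
near=> d.
have d0 : d < 0 by near: d; exact: nbhs_left_lt.
have xd : x0 + d < x0 by rewrite gtrDl.
have ad : a < x0 + d.
  by rewrite -ltrBlDl; near: d; apply: nbhs_left_gt; rewrite subr_lt0.
have Ix : I (x0 + d) by apply: (itvI a x0 Ia Ib); rewrite !ltW.
have := mean_le_relpos _ _ _ _ _ _ itvI hg gg Ia Ib ad xd hlg.
have /andP[_ g1] := relpos_itv _ _ _ _ _ gg.2 Ia Ib Ix ad xd.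
have /andP[_ h1] := relpos_itv _ _ _ _ _ hg.2 Ia Ib Ix ad xd.
(* With the right end anchored at [x0], the relative position is 1 there, so the increment from [x0]
   appears in its distance to 1. *)
have compl k : k x0 - k a != 0 ->
    relpos k a x0 (x0 + d) - 1 = (k (x0 + d) - k x0) / (k x0 - k a).
  by move=> k0; rewrite /relpos; field.
(* Both differences from 1 are negative, so the order flips on passing to absolute values. *)
rewrite -(lerD2r (- 1)) -lerN2 => le_hg.
have : `|relpos h a x0 (x0 + d) - 1| <= `|relpos g a x0 (x0 + d) - 1|.
  by rewrite !ltr0_norm // subr_lt0.
rewrite !compl // !normf_div ler_pdivrMr ?normr_gt0 // => {}le_hg.
rewrite mulrA ler_pM2r ?invr_gt0 ?normr_gt0 ?lt_eqF //.
by rewrite mulrAC -mulrA mulrC.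
Unshelve. all: by end_near. Qed.

End RelativePosition.

Theorem corollary2 (R : realType) (I : set R) (x0 : R)
    (hI : is_interval I) (hx0 : I x0) :
  (x0%:E <> ereal_sup (EFin @` I) -> interval_type (@right_flat_means R I x0)) /\
  (x0%:E <> ereal_inf (EFin @` I) -> interval_type (@left_flat_means R I x0)).
Proof.
split.
  move=> /(sup_neq_gt _ _ hx0)[b Ib xb]; split.
    by move=> _ [f [fg _] <-]; exists f.
  (* The given generator [h] is itself flat on the right, by comparison with the lower mean. *)
  move=> _ _ _ [f [fg f0] <-] _ [h hg <-] fh _; exists h => //; split => //.
  exact: (is_right_derive0_mean_le _ f _ _ b hI).
move=> /(inf_neq_lt _ _ hx0)[a Ia ax]; split.
  by move=> _ [f [fg _] <-]; exists f.
(* On the left, flatness of [h] comes from the upper mean. *)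
move=> _ _ _ _ [g [gg g0] <-] [h hg <-] _ hg'; exists h => //; split => //.
exact: (is_left_derive0_mean_le _ g _ _ a hI).
Qed.
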